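(* Let $X$ be a real algebraic set with normalization map $\pi':X'\to X$. The rings $\mathcal O(X)'$ and $\mathcal O(X')$ are isomorphic if and only if $X$ has a totally real normalization.
   Context: A real algebraic set $X\subset\mathbb R^n$ is the set of common zeros in $\mathbb R^n$ of some polynomials; $\mathcal P(X)=\mathbb R[x_1,\dots,x_n]/\mathcal I(X)$, where $\mathcal I(X)$ is the ideal of polynomials vanishing on $X$. The ring of regular functions is $\mathcal O(X)=\mathcal S(X)^{-1}\mathcal P(X)$ with $\mathcal S(X)$ the set of $f\in\mathcal P(X)$ with no zero on $X$. $\mathcal K(X)$ is the total ring of fractions of $\mathcal P(X)$ (also that of $\mathcal O(X)$), and $\mathcal O(X)'$ is the integral closure of $\mathcal O(X)$ in $\mathcal K(X)$. The normalization $X'$ is the real algebraic set whose ring $\mathcal P(X')$ of polynomial functions is the integral closure of $\mathcal P(X)$ in $\mathcal K(X)$; $\pi':X'\to X$ is the polynomial map induced by $\mathcal P(X)\subset\mathcal P(X')$. The complexification $X_{\mathbb C}\subset\mathbb C^n$ of $X\subset \mathbb R^n$ is the complex algebraic set with ring of polynomial functions $\mathcal P(X)\otimes_{\mathbb R}\mathbb C$; $X$ is viewed as a subset of $X_{\mathbb C}$, and $\pi'$ extends to $\pi'_{\mathbb C}:X'_{\mathbb C}\to X_{\mathbb C}$. $X$ has a totally real normalization if $(\pi'_{\mathbb C})^{-1}(X)=X'$. *)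

(* Defs.v *)
From HB Require Import structures.
From mathcomp Require Import all_boot all_order all_algebra.
From mathcomp Require Import generic_quotient ring_quotient mxpoly ring.
From mathcomp Require Import boolp classical_sets reals complex mpoly.

Set Implicit Arguments.
Unset Strict Implicit.
Unset Printing Implicit Defensive.

Import GRing.Theory.

Local Open Scope ring_scope.
Local Open Scope quotient_scope.

(* Rings are "Pz" (0 = 1 allowed) throughout: the empty set is a real algebraic
   set, and its ring of polynomial functions is the zero ring. *)

Definition ring_isomorphic (A B : pzRingType) : Prop :=
  exists f : {rmorphism A -> B}, bijective f.

Section Localization.

Variables (A : comPzRingType) (S : mulrClosed A).

Definition fracpair : Type := (A * {s : A | s \in S})%type.
HB.instance Definition _ := Choice.on fracpair.

Definition mkpair (a s : A) (sS : s \in S) : fracpair := (a, exist _ s sS).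

Implicit Types x y z : fracpair.

Local Notation den x := (sval x.2).

Lemma den_in x : den x \in S. Proof. exact: (svalP x.2). Qed.

Definition loc_equiv x y : bool :=
  `[< exists2 u, u \in S & u * (x.1 * den y) = u * (y.1 * den x) >].

Lemma loc_equiv_refl : reflexive loc_equiv.
Proof. by move=> x; apply/asboolP; exists 1; rewrite ?rpred1. Qed.

Lemma loc_equiv_sym : ssrbool.symmetric loc_equiv.
Proof.
by move=> x y; apply/asboolP/asboolP=> -[u uS e]; exists u; rewrite ?e.
Qed.

Lemma loc_equiv_trans : transitive loc_equiv.
Proof.
move=> y x z /asboolP[u uS e] /asboolP[v vS f]; apply/asboolP.
exists (u * v * den y); first by rewrite !rpredM ?den_in.
transitivity (v * den z * (u * (x.1 * den y))); first by ring.
rewrite e; transitivity (u * den x * (v * (y.1 * den z))); first by ring.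
by rewrite f; ring.
Qed.

Canonical loc_equiv_equiv :=
  EquivRel loc_equiv loc_equiv_refl loc_equiv_sym loc_equiv_trans.

Definition loc : Type := {eq_quot loc_equiv}.
HB.instance Definition _ : EqQuotient _ loc_equiv loc := EqQuotient.on loc.
HB.instance Definition _ := Choice.on loc.

Definition loc_frac (a s : A) (sS : s \in S) : loc := \pi_loc (mkpair a sS).

Lemma loc_eqP x y :
  reflect (exists2 u, u \in S & u * (x.1 * den y) = u * (y.1 * den x))
          (\pi_loc x == \pi_loc y).
Proof. by rewrite eqmodE; apply: asboolP. Qed.

Lemma repr_loc x :
  exists2 u, u \in S &
    u * ((repr (\pi_loc x)).1 * den x) = u * (x.1 * den (repr (\pi_loc x))).
Proof. by apply/loc_eqP; rewrite reprK. Qed.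

Definition addp x y : fracpair :=
  mkpair (x.1 * den y + y.1 * den x) (rpredM (den_in x) (den_in y)).
Definition mulp x y : fracpair :=
  mkpair (x.1 * y.1) (rpredM (den_in x) (den_in y)).
Definition oppp x : fracpair := mkpair (- x.1) (den_in x).

Definition loc_zero : loc := \pi_loc (mkpair 0 (rpred1 S)).
Definition loc_one : loc := \pi_loc (mkpair 1 (rpred1 S)).
Definition loc_add : loc -> loc -> loc := lift_op2 loc addp.
Definition loc_mul : loc -> loc -> loc := lift_op2 loc mulp.
Definition loc_opp : loc -> loc := lift_op1 loc oppp.

Lemma loc_addE x y : loc_add (\pi_loc x) (\pi_loc y) = \pi_loc (addp x y).
Proof.
rewrite /loc_add; unlock.
have [u uS eu] := repr_loc x; have [v vS ev] := repr_loc y.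
apply/eqP/loc_eqP; exists (u * v); first exact: rpredM.
move: (repr (\pi_loc x)) (repr (\pi_loc y)) eu ev => x' y' eu ev /=.
transitivity (v * den y * den y' * (u * (x'.1 * den x))
              + u * den x * den x' * (v * (y'.1 * den y))); first by ring.
by rewrite eu ev; ring.
Qed.

Lemma loc_mulE x y : loc_mul (\pi_loc x) (\pi_loc y) = \pi_loc (mulp x y).
Proof.
rewrite /loc_mul; unlock.
have [u uS eu] := repr_loc x; have [v vS ev] := repr_loc y.
apply/eqP/loc_eqP; exists (u * v); first exact: rpredM.
move: (repr (\pi_loc x)) (repr (\pi_loc y)) eu ev => x' y' eu ev /=.
transitivity ((u * (x'.1 * den x)) * (v * (y'.1 * den y))); first by ring.
by rewrite eu ev; ring.
Qed.

Lemma loc_oppE x : loc_opp (\pi_loc x) = \pi_loc (oppp x).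
Proof.
rewrite /loc_opp; unlock.
have [u uS eu] := repr_loc x.
apply/eqP/loc_eqP; exists u => //.
move: (repr _) eu => x' eu /=.
transitivity (- (u * (x'.1 * den x))); first by ring.
by rewrite eu; ring.
Qed.

Lemma loc_eq x y : x.1 * den y = y.1 * den x -> \pi_loc x = \pi_loc y.
Proof. by move=> e; apply/eqP/loc_eqP; exists 1; rewrite ?rpred1 ?e. Qed.

Lemma loc_addA : associative loc_add.
Proof.
elim/quotW=> x; elim/quotW=> y; elim/quotW=> z.
by rewrite !loc_addE; apply: loc_eq => /=; ring.
Qed.

Lemma loc_addC : commutative loc_add.
Proof.
elim/quotW=> x; elim/quotW=> y.
by rewrite !loc_addE; apply: loc_eq => /=; ring.
Qed.

Lemma loc_add0 : left_id loc_zero loc_add.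
Proof. by elim/quotW=> x; rewrite loc_addE; apply: loc_eq => /=; ring. Qed.

Lemma loc_addN : left_inverse loc_zero loc_opp loc_add.
Proof.
by elim/quotW=> x; rewrite loc_oppE loc_addE; apply: loc_eq => /=; ring.
Qed.

HB.instance Definition _ :=
  GRing.isZmodule.Build loc loc_addA loc_addC loc_add0 loc_addN.

Lemma loc_mulA : associative loc_mul.
Proof.
elim/quotW=> x; elim/quotW=> y; elim/quotW=> z.
by rewrite !loc_mulE; apply: loc_eq => /=; ring.
Qed.

Lemma loc_mulC : commutative loc_mul.
Proof.
elim/quotW=> x; elim/quotW=> y.
by rewrite !loc_mulE; apply: loc_eq => /=; ring.
Qed.

Lemma loc_mul1 : left_id loc_one loc_mul.
Proof. by elim/quotW=> x; rewrite loc_mulE; apply: loc_eq => /=; ring. Qed.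

Lemma loc_mulDl : left_distributive loc_mul loc_add.
Proof.
elim/quotW=> x; elim/quotW=> y; elim/quotW=> z.
by rewrite !(loc_addE, loc_mulE); apply: loc_eq => /=; ring.
Qed.

HB.instance Definition _ :=
  GRing.Zmodule_isComPzRing.Build loc loc_mulA loc_mulC loc_mul1 loc_mulDl.

Lemma loc_fracD a b s t (sS : s \in S) (tS : t \in S) :
  loc_frac a sS + loc_frac b tS = loc_frac (a * t + b * s) (rpredM sS tS).
Proof. by rewrite [LHS]loc_addE; apply: loc_eq. Qed.

Lemma loc_fracM a b s t (sS : s \in S) (tS : t \in S) :
  loc_frac a sS * loc_frac b tS = loc_frac (a * b) (rpredM sS tS).
Proof. by rewrite [LHS]loc_mulE; apply: loc_eq. Qed.

Lemma loc_fracN a s (sS : s \in S) : - loc_frac a sS = loc_frac (- a) sS.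
Proof. by rewrite [LHS]loc_oppE; apply: loc_eq. Qed.

Lemma loc_frac_eqP a b s t (sS : s \in S) (tS : t \in S) :
  loc_frac a sS = loc_frac b tS <->
  exists2 u, u \in S & u * (a * t) = u * (b * s).
Proof. by split=> [/eqP/loc_eqP|e]//; apply/eqP/loc_eqP. Qed.

Lemma loc_fracP (x : loc) : exists a s (sS : s \in S), x = loc_frac a sS.
Proof. by elim/quotW: x => -[a [s sS]]; exists a, s, sS. Qed.

Definition loc_inj (a : A) : loc := loc_frac a (rpred1 S).

Lemma loc_inj_zmod : zmod_morphism loc_inj.
Proof.
by move=> a b; rewrite loc_fracN loc_fracD; apply: loc_eq => /=; ring.
Qed.

Lemma loc_inj_monoid : monoid_morphism loc_inj.
Proof.
by split=> [|a b]; rewrite ?loc_fracM //; apply: loc_eq => /=; ring.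
Qed.

HB.instance Definition _ := GRing.isZmodMorphism.Build A loc loc_inj loc_inj_zmod.
HB.instance Definition _ :=
  GRing.isMonoidMorphism.Build A loc loc_inj loc_inj_monoid.

End Localization.

Section LocalizationMap.

Variables (A : comPzRingType) (S T : mulrClosed A).
Hypothesis ST : {subset S <= T}.

Definition loc_map (x : loc S) : loc T :=
  loc_frac (repr x).1 (ST (den_in (repr x))).

Lemma loc_map_frac a s (sS : s \in S) :
  loc_map (loc_frac a sS) = loc_frac a (ST sS).
Proof.
have [u uS e] := repr_loc (mkpair a sS).
by apply/loc_frac_eqP; exists u => //; apply: ST.
Qed.

Lemma loc_map_zmod : zmod_morphism loc_map.
Proof.
move=> x y; have [a [s [sS ->]]] := loc_fracP x.
have [b [t [tS ->]]] := loc_fracP y.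
by rewrite !(loc_fracN, loc_fracD, loc_map_frac); apply: loc_eq => /=; ring.
Qed.

Lemma loc_map_monoid : monoid_morphism loc_map.
Proof.
split=> [|x y].
  by rewrite [X in loc_map X]/1 /= loc_map_frac; apply: loc_eq => /=; ring.
have [a [s [sS ->]]] := loc_fracP x; have [b [t [tS ->]]] := loc_fracP y.
by rewrite !(loc_fracM, loc_map_frac); apply: loc_eq => /=; ring.
Qed.

HB.instance Definition _ :=
  GRing.isZmodMorphism.Build (loc S) (loc T) loc_map loc_map_zmod.
HB.instance Definition _ :=
  GRing.isMonoidMorphism.Build (loc S) (loc T) loc_map loc_map_monoid.

End LocalizationMap.

Section TotalFractions.

Variable A : comPzRingType.

Definition nonzerodiv : {pred A} := fun s => `[< GRing.lreg s >].

Lemma nonzerodiv_mulr : mulr_closed nonzerodiv.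
Proof.
split=> [|s t /asboolP sreg /asboolP treg]; apply/asboolP.
  exact: lreg1.
exact: lregM.
Qed.

HB.instance Definition _ :=
  GRing.isMulClosed.Build A nonzerodiv nonzerodiv_mulr.

Definition totfrac : comPzRingType := loc nonzerodiv.

End TotalFractions.

Section IntegralClosure.

Variables (A B : comPzRingType) (f : {rmorphism A -> B}).

(* mxpoly's integralOver, with the monic polynomial written out, because
   {poly _} requires a non-zero coefficient ring. *)
Definition integral_over : {pred B} := fun b =>
  `[< exists (d : nat) (c : 'I_d -> A),
        b ^+ d + \sum_(i < d) f (c i) * b ^+ i = 0 >].

End IntegralClosure.

Lemma integral_overE (A B : comNzRingType) (f : {rmorphism A -> B}) (b : B) :
  b \in integral_over f <-> integralOver f b.
Proof.
split=> [/asboolP[d [c e]]|[p pmon proot]].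
  pose q : {poly A} := \poly_(i < d) (if insub i is Some j then c j else 0).
  have sz : (size q <= d)%N by exact: size_poly.
  exists ('X^d + q).
    by rewrite monicE lead_coefDl ?lead_coefXn // size_polyXn ltnS.
  rewrite /root rmorphD /= map_polyXn hornerD hornerXn.
  rewrite (horner_coef_wide _ (leq_trans (size_poly _ _) sz)) /=.
  rewrite -[X in _ == X]e; apply/eqP; congr (_ + _); apply: eq_bigr => i _.
  by rewrite coef_map coef_poly ltn_ord valK.
move: (polySpred (monic_neq0 pmon)); move: (size p).-1 => d sz_p.
have pd1 : p`_d = 1 by move/monicP: pmon; rewrite lead_coefE sz_p.
apply/asboolP; exists d, (fun i => p`_i).
move/eqP: proot; rewrite horner_coef size_map_poly_id0; last first.
  by rewrite (monicP pmon) rmorph1 oner_neq0.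
rewrite sz_p big_ord_recr /= coef_map /= pd1 rmorph1 mul1r addrC => e.
by rewrite -[RHS]e; congr (_ + _); apply: eq_bigr => i _; rewrite coef_map.
Qed.

Lemma integral_over_subring (A B : comPzRingType) (f : {rmorphism A -> B}) :
  subring_closed (integral_over f).
Proof.
suff nonzero (A' B' : comNzRingType) (f' : {rmorphism A' -> B'}) :
    subring_closed (integral_over f').
  have [B0|B1] := eqVneq (1 : B) 0.
    suff inB b : b \in integral_over f by split.
    apply/asboolP; exists 0, (fun=> 0).
    by rewrite expr0 B0 big_ord0 addr0.
  have A1 : (1 : A) != 0.
    by apply: contra_neq B1 => A0; rewrite -(rmorph1 f) A0 rmorph0.
  pose A' := HB.pack_for comNzRingType (GRing.ComPzRing.sort A)
               (GRing.PzSemiRing_isNonZero.Build _ A1).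
  pose B' := HB.pack_for comNzRingType (GRing.ComPzRing.sort B)
               (GRing.PzSemiRing_isNonZero.Build _ B1).
  exact: (nonzero A' B' f).
split=> [|x y /integral_overE xi /integral_overE yi
         |x y /integral_overE xi /integral_overE yi]; apply/integral_overE.
- exact: integral1.
- exact: integral_sub.
- exact: integral_mul.
Qed.

HB.instance Definition _ (A B : comPzRingType) (f : {rmorphism A -> B}) :=
  GRing.isSubringClosed.Build B (integral_over f) (integral_over_subring f).

Record intclosure (A B : comPzRingType) (f : {rmorphism A -> B}) :=
  IntClosure { intclosure_val :> B; _ : intclosure_val \in integral_over f }.

Section IntClosureRing.

Variables (A B : comPzRingType) (f : {rmorphism A -> B}).

HB.instance Definition _ := [isSub for @intclosure_val A B f].
HB.instance Definition _ := [Choice of intclosure f by <:].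
HB.instance Definition _ := GRing.SubChoice_isSubComPzRing.Build
  B (integral_over f) (intclosure f) (integral_over_subring f).

End IntClosureRing.

Section RealAlgebraicSets.

Variables (R : realType) (n : nat).
Implicit Types (X : set 'rV[R]_n) (p q : {mpoly R[n]}) (x : 'rV[R]_n).

Definition real_algebraic X : Prop :=
  exists P : set {mpoly R[n]}, X = [set x | forall p, P p -> p.@[x ord0] = 0]%classic.

Definition vanishing X : {pred {mpoly R[n]}} :=
  fun p => `[< forall x, X x -> p.@[x ord0] = 0 >].

Lemma vanishing_zmod X : zmod_closed (vanishing X).
Proof.
split=> [|p q /asboolP p0 /asboolP q0]; apply/asboolP=> x Xx.
  by rewrite meval0.
by rewrite mevalB p0 // q0 // subrr.
Qed.

HB.instance Definition _ X :=
  GRing.isZmodClosed.Build {mpoly R[n]} (vanishing X) (vanishing_zmod X).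

Lemma vanishingMl X p q : q \in vanishing X -> p * q \in vanishing X.
Proof.
by move=> /asboolP q0; apply/asboolP=> x Xx; rewrite mevalM q0 // mulr0.
Qed.

(* ring_quotient's {ideal_quot _} is restricted to proper ideals, and the
   vanishing ideal of the empty set is not proper; only the additive group
   structure can be taken from there. *)
Definition polyfun X : Type := Quotient.quot (vanishing X).

HB.instance Definition _ X := GRing.Zmodule.on (polyfun X).

Definition polyfun_class X p : polyfun X := \pi_(Quotient.quot (vanishing X)) p.

Lemma polyfun_classP X p q :
  polyfun_class X p = polyfun_class X q <->
  forall x, X x -> p.@[x ord0] = q.@[x ord0].
Proof.
rewrite /polyfun_class; split=> [/eqP|pq].
  rewrite -Quotient.idealrBE => /asboolP pq x Xx.
  by apply/eqP; rewrite -subr_eq0 -mevalB pq.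
apply/eqP; rewrite -Quotient.idealrBE; apply/asboolP=> x Xx.
by rewrite mevalB pq // subrr.
Qed.

Definition polyfun_repr X (f : polyfun X) : {mpoly R[n]} :=
  repr (f : Quotient.quot (vanishing X)).

Lemma polyfun_reprK X (f : polyfun X) : polyfun_class X (polyfun_repr f) = f.
Proof. exact: reprK. Qed.

(* Only meaningful at points x of X. *)
Definition polyfun_eval X (f : polyfun X) x : R := (polyfun_repr f).@[x ord0].

Lemma polyfun_evalE X p x :
  X x -> polyfun_eval (polyfun_class X p) x = p.@[x ord0].
Proof. by move: x; apply/polyfun_classP; apply: polyfun_reprK. Qed.

Lemma polyfun_ext X (f g : polyfun X) :
  (forall x, X x -> polyfun_eval f x = polyfun_eval g x) -> f = g.
Proof.
by move=> fg; rewrite -[f]polyfun_reprK -[g]polyfun_reprK; apply/polyfun_classP.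
Qed.

Lemma polyfun_classB X p q :
  polyfun_class X (p - q) = polyfun_class X p - polyfun_class X q.
Proof. by rewrite /polyfun_class !piE. Qed.

Lemma polyfun_classD X p q :
  polyfun_class X (p + q) = polyfun_class X p + polyfun_class X q.
Proof. by rewrite /polyfun_class !piE. Qed.

Definition polyfun_one X : polyfun X := polyfun_class X 1.
Definition polyfun_mul X (f g : polyfun X) : polyfun X :=
  polyfun_class X (polyfun_repr f * polyfun_repr g).

Lemma polyfun_evalD X (f g : polyfun X) x :
  X x -> polyfun_eval (f + g) x = polyfun_eval f x + polyfun_eval g x.
Proof.
move=> Xx; rewrite -[f in LHS]polyfun_reprK -[g in LHS]polyfun_reprK.
by rewrite -polyfun_classD polyfun_evalE // mevalD.
Qed.

Lemma polyfun_eval_mul X (f g : polyfun X) x :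
  X x -> polyfun_eval (polyfun_mul f g) x = polyfun_eval f x * polyfun_eval g x.
Proof. by move=> Xx; rewrite polyfun_evalE // mevalM. Qed.

Lemma polyfun_eval_one X x : X x -> polyfun_eval (polyfun_one X) x = 1.
Proof. by move=> Xx; rewrite polyfun_evalE // meval1. Qed.

Lemma polyfun_mulA X : associative (@polyfun_mul X).
Proof.
by move=> f g h; apply: polyfun_ext => x Xx; rewrite !polyfun_eval_mul // mulrA.
Qed.

Lemma polyfun_mulC X : commutative (@polyfun_mul X).
Proof.
by move=> f g; apply: polyfun_ext => x Xx; rewrite !polyfun_eval_mul // mulrC.
Qed.

Lemma polyfun_mul1 X : left_id (polyfun_one X) (@polyfun_mul X).
Proof.
move=> f; apply: polyfun_ext => x Xx.
by rewrite polyfun_eval_mul // polyfun_eval_one // mul1r.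
Qed.

Lemma polyfun_mulDl X : left_distributive (@polyfun_mul X) +%R.
Proof.
move=> f g h; apply: polyfun_ext => x Xx.
by rewrite !(polyfun_eval_mul, polyfun_evalD) // mulrDl.
Qed.

HB.instance Definition _ X :=
  GRing.Zmodule_isComPzRing.Build (polyfun X)
    (@polyfun_mulA X) (@polyfun_mulC X) (@polyfun_mul1 X) (@polyfun_mulDl X).

Lemma polyfun_class_monoid X : monoid_morphism (polyfun_class X).
Proof.
split=> // p q; apply: polyfun_ext => x Xx.
by rewrite polyfun_eval_mul // !polyfun_evalE // mevalM.
Qed.

HB.instance Definition _ X := GRing.isZmodMorphism.Build
  {mpoly R[n]} (polyfun X) (polyfun_class X) (@polyfun_classB X).
HB.instance Definition _ X := GRing.isMonoidMorphism.Build
  {mpoly R[n]} (polyfun X) (polyfun_class X) (polyfun_class_monoid X).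

Definition nowhere_zero X : {pred (polyfun X)} :=
  fun f => `[< forall x, X x -> polyfun_eval f x != 0 >].

Lemma nowhere_zero_mulr X : mulr_closed (@nowhere_zero X).
Proof.
split=> [|f g /asboolP f0 /asboolP g0]; apply/asboolP=> x Xx.
  by rewrite polyfun_eval_one // oner_neq0.
by rewrite polyfun_eval_mul // mulf_neq0 ?f0 ?g0.
Qed.

HB.instance Definition _ X := GRing.isMulClosed.Build
  (polyfun X) (@nowhere_zero X) (@nowhere_zero_mulr X).

Definition regular X : comPzRingType := loc (@nowhere_zero X).

Lemma nowhere_zero_nonzerodiv X :
  {subset @nowhere_zero X <= @nonzerodiv (polyfun X)}.
Proof.
move=> f /asboolP f0; apply/asboolP=> g h fgh.
apply: polyfun_ext => x Xx; apply: (mulfI (f0 x Xx)).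
by rewrite -!polyfun_eval_mul //; congr (polyfun_eval _ x).
Qed.

Definition polyfun_frac X : {rmorphism polyfun X -> totfrac (polyfun X)} :=
  @loc_inj (polyfun X) (@nonzerodiv (polyfun X)).
Definition regular_frac X : {rmorphism regular X -> totfrac (polyfun X)} :=
  loc_map (@nowhere_zero_nonzerodiv X).

Local Open Scope classical_set_scope.

Definition real_points X : set 'rV[R[i]]_n := map_mx (real_complex R) @` X.

(* By complexification_vanishing below, the ideal of this complex algebraic set
   is I(X) (x) C, so that its ring of polynomial functions is P(X) (x) C. *)
Definition complexification X : set 'rV[R[i]]_n :=
  [set z | forall p, p \in vanishing X ->
     (map_mpoly (real_complex R) p).@[z ord0] = 0].

End RealAlgebraicSets.

Lemma meval_map_mpoly (A B : comNzRingType) (f : {rmorphism A -> B}) n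
    (q : {mpoly A[n]}) (v : 'I_n -> A) :
  (map_mpoly f q).@[fun i => f (v i)] = f q.@[v].
Proof.
rewrite [q]mpolyE; elim/big_rec: _ => [|m r _ IH].
  by rewrite !(rmorph0, meval0).
rewrite raddfD /= !mevalD IH [in RHS]rmorphD; congr (_ + _).
rewrite map_mpolyZ map_mpolyX !mevalZ [in RHS]rmorphM !mevalX; congr (_ * _).
by rewrite rmorph_prod; apply: eq_bigr => i _; rewrite rmorphXn.
Qed.

Lemma complexification_vanishing (R : realType) n (X : set 'rV[R]_n) (p : {mpoly R[i][n]}) :
  (forall z, complexification X z -> p.@[z ord0] = 0) <->
  map_mpoly (@complex.Re R) p \in vanishing X /\
  map_mpoly (@complex.Im R) p \in vanishing X.
Proof.
pose C : {rmorphism R -> R[i]} := real_complex R.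
have pE : p = map_mpoly C (map_mpoly (@complex.Re R) p)
            + ('i%C : R[i]) *: map_mpoly C (map_mpoly (@complex.Im R) p).
  apply/mpolyP=> k; rewrite [RHS]mcoeffD [X in _ + X]mcoeffZ.
  have eR := etrans (mcoeff_map_mpoly C k _)
               (congr1 C (mcoeff_map_mpoly (@complex.Re R) k p)).
  have eI := etrans (mcoeff_map_mpoly C k _)
               (congr1 C (mcoeff_map_mpoly (@complex.Im R) k p)).
  apply: esym; apply: etrans (congr2 (fun a b => a + 'i%C * b) eR eI) _.
  by case: (p@_k) => a b; simpc.
have evC (q : {mpoly R[n]}) (x : 'rV[R]_n) :
    (map_mpoly C q).@[map_mx C x ord0] = C (q.@[x ord0]).
  rewrite -[RHS](@meval_map_mpoly _ _ C n q (x ord0)).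
  by apply: meval_eq => i; rewrite mxE.
have pRI (x : 'rV[R]_n) : p.@[map_mx C x ord0] =
    C (map_mpoly (@complex.Re R) p).@[x ord0]
    + 'i%C * C (map_mpoly (@complex.Im R) p).@[x ord0].
  by rewrite [in LHS]pE mevalD mevalZ; congr (_ + _ * _); apply: evC.
split=> [p0|[pR pI] z Xz]; last first.
  rewrite pE [LHS]mevalD [X in _ + X]mevalZ.
  apply: etrans (congr2 (fun a b => a + 'i%C * b) (Xz _ pR) (Xz _ pI)) _.
  by rewrite mulr0 addr0.
suff H x : X x -> (map_mpoly (@complex.Re R) p).@[x ord0] = 0 /\
                  (map_mpoly (@complex.Im R) p).@[x ord0] = 0.
  by split; apply/asboolP=> x /H[].
move=> Xx; have e : p.@[map_mx C x ord0] = 0.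
  apply: p0 => q /asboolP q0; apply: etrans (evC q x) _.
  by rewrite q0 // rmorph0.
by move: e; rewrite pRI; simpc; case=> -> ->.
Qed.

Section PolynomialMaps.

Variables (R : realType) (n m : nat) (u : n.-tuple {mpoly R[m]}).

Definition polymap (y : 'rV[R]_m) : 'rV[R]_n := \row_i (tnth u i).@[y ord0].

Definition polymapC (z : 'rV[R[i]]_m) : 'rV[R[i]]_n :=
  \row_i (map_mpoly (real_complex R) (tnth u i)).@[z ord0].

End PolynomialMaps.

Section Normalization.

Local Open Scope classical_set_scope.

Variables (R : realType) (n m : nat).
Variables (X : set 'rV[R]_n) (X' : set 'rV[R]_m) (u : n.-tuple {mpoly R[m]}).

(* (X', u) is determined by X up to isomorphism only: u : X' -> X is a
   polynomial map such that P(X') is isomorphic to the integral closure of P(X)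
   in K(X), the composition with u corresponding to the inclusion of P(X). *)
Definition is_normalization : Prop :=
  [/\ real_algebraic X',
      polymap u @` X' `<=` X &
      exists phi : {rmorphism polyfun X' -> intclosure (@polyfun_frac R n X)},
        bijective phi /\
        forall p : {mpoly R[n]},
          \val (phi (polyfun_class X' (p \mPo u))) =
          polyfun_frac X (polyfun_class X p)].

Definition totally_real_normalization : Prop :=
  complexification X' `&` polymapC u @^-1` real_points X = real_points X'.

End Normalization.

(* Main.v *)
Require Import Defs.
From HB Require Import structures.
From mathcomp Require Import all_boot all_order all_algebra.
From mathcomp Require Import ring.
From mathcomp Require Import boolp classical_sets reals complex mpoly.

(** Write A for P(X), K for its total ring of fractions, S for the functions of
    A without zero on X, and B for P(X'), identified with the integral closure
    of A in K by an injective morphism Phi ([normalization_embedding]).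
    Clearing denominators in an integral equation shows that O(X)' is the
    localization of B at S, whereas O(X') is the localization of B at the
    larger set S' of functions without zero on X'. Everything is about whether
    the elements of S' are already invertible in O(X)', that is, whether each
    of them divides some s o pi' with s in S.

    Suppose that the normalization is totally real, and let t be in S'. The
    elements p of A such that t divides p o pi' form an ideal J. If J had a
    zero x on X, then lying over ([lying_over]) would extend evaluation at x,
    which kills the contraction J of the ideal tB, to a morphism from B to the
    complex numbers that kills t. Such a morphism is evaluation at a point of
    the complexification of X' lying over x; that point is real by hypothesis,
    so it is a zero of t on X', which is absurd. Hence J has no zero on X; by
    the Hilbert basis theorem ([noetherian_mpoly]) J has finitely many
    generators, and the sum of their squares is an element of J without zero
    on X ([totally_real_divisor]). So O(X)' = O(X') ([regular_closure_iso]).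

    Conversely 1 + f^2 is invertible for every f in O(X'), and an isomorphism
    of rings, whatever it is, transports this property to O(X)'. If z is a
    nonreal point of the complexification of X' lying over a real point x of X,
    then some b in B takes the value i at z. Clearing denominators in the
    inverse of 1 + b^2 gives c in B and s in S with c (1 + b^2) = s o pi'
    ([regular_closure_sqrD1]), and evaluation at z yields s(x) = 0, a
    contradiction. *)

Set Implicit Arguments.
Unset Strict Implicit.
Unset Printing Implicit Defensive.

Import GRing.Theory Num.Theory.

Local Open Scope ring_scope.

(** * Noetherian rings and the Hilbert basis theorem *)

(** Ideals are Prop-valued, since those used below are defined by existential
    statements or by evaluation at a point. *)
Record ideal (A : comNzRingType) (I : A -> Prop) : Prop := Ideal {
  ideal0 : I 0;
  idealD : forall a b, I a -> I b -> I (a + b);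
  idealMl : forall a b, I b -> I (a * b) }.

Lemma idealB (A : comNzRingType) (I : A -> Prop) a b :
  ideal I -> I a -> I b -> I (a - b).
Proof.
by move=> idI Ia Ib; rewrite -mulN1r; apply: idealD => //; apply: idealMl.
Qed.

(** Finite generation is expressed by minimality: an ideal that contains the
    generators contains [I]. This avoids explicit linear combinations. *)
Definition noetherian (A : comNzRingType) : Prop :=
  forall I : A -> Prop, ideal I -> exists s : seq A,
    {in s, forall a, I a} /\
    forall K : A -> Prop, ideal K -> {in s, forall a, K a} ->
      forall a, I a -> K a.

Lemma noetherian_field (F : fieldType) : noetherian F.
Proof.
move=> I idI; have [[a [Ia a0]]|I0] := pselect (exists a, I a /\ a != 0).
  exists [:: a]; split=> [b|K idK Ka b _]; first by rewrite inE => /eqP->.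
  rewrite -[b](divfK a0); apply: idealMl => //.
  by apply: Ka; rewrite inE.
exists [::]; split=> // K idK _ a Ia.
have [->|a0] := eqVneq a 0; first exact: ideal0.
by case: I0; exists a.
Qed.

Lemma noetherian_surj (A B : comNzRingType) (f : {rmorphism A -> B}) :
  (forall b, exists a, f a = b) -> noetherian A -> noetherian B.
Proof.
move=> surjf noethA I idI.
have preim (K : B -> Prop) : ideal K -> ideal (fun a => K (f a)).
  move=> idK; split=> [|a b|a b]; rewrite ?rmorph0 ?rmorphD ?rmorphM.
  - exact: ideal0.
  - exact: idealD.
  - exact: idealMl.
have [s [sI gens]] := noethA _ (preim _ idI).
exists (map f s); split=> [_ /mapP[a /sI Ia ->]//|K idK sK b].
have [a <-] := surjf b; apply: gens (preim _ idK) _ _ => c cs.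
by apply: sK; apply: map_f.
Qed.

Section HilbertBasis.

Variables (A : comNzRingType) (noethA : noetherian A).
Variables (I : {poly A} -> Prop) (idI : ideal I).

(** Allowing degrees below [d] adds 0 to the leading coefficients in degree [d],
    which makes them an ideal. *)
Definition top_coef (I : {poly A} -> Prop) (d : nat) (a : A) : Prop :=
  exists p : {poly A}, [/\ I p, (size p <= d.+1)%N & p`_d = a].

Lemma top_coef_ideal (J : {poly A} -> Prop) d : ideal J -> ideal (top_coef J d).
Proof.
move=> idJ; split=> [|a b [p [Jp szp <-]] [q [Jq szq <-]]|a b [p [Jp szp <-]]].
- by exists 0; rewrite size_poly0 coef0; split=> //; apply: ideal0.
- exists (p + q); rewrite coefD; split=> //; first exact: idealD.
  by rewrite (leq_trans (size_polyD _ _)) // geq_max szp.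
- exists (a%:P * p); rewrite coefCM; split=> //; first exact: idealMl.
  by rewrite mul_polyC (leq_trans (size_scale_leq _ _)).
Qed.

Lemma top_coefS d e a : (d <= e)%N -> top_coef I d a -> top_coef I e a.
Proof.
move=> de [p [Ip szp <-]]; exists ('X^(e - d) * p); split.
- exact: idealMl.
- rewrite (leq_trans (size_polyMleq _ _)) // size_polyXn addSn /=.
  by rewrite -[X in (_ <= X.+1)%N](subnK de) -addnS leq_add2l.
- by rewrite mulrC coefMXn ltnNge leq_subr /= subKn.
Qed.

(** Lifts to [I] of generators of the coefficient ideal. The conclusion is what
    the division step needs: any leading coefficient in degree [d] is that of
    some polynomial in both [I] and the ideal generated by the lifts. *)
Lemma top_coef_gens d : exists t : seq {poly A},
  {in t, forall p, I p} /\
  forall K : {poly A} -> Prop, ideal K -> {in t, forall p, K p} ->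
    forall a, top_coef I d a -> top_coef (fun p => I p /\ K p) d a.
Proof.
have [s [sI gens]] := noethA (top_coef_ideal d idI).
have [t [tI st]] : exists t : seq {poly A}, {in t, forall p, I p} /\
    {in s, forall a, exists2 p, p \in t & (size p <= d.+1)%N /\ p`_d = a}.
  elim: s sI {gens} => [|a s IHs] sI; first by exists [::].
  have [p [Ip szp pa]] := sI a (mem_head _ _).
  have [b bs|t [tI st]] := IHs; first by apply: sI; rewrite inE bs orbT.
  exists (p :: t); split=> [q|b]; rewrite inE.
    by case/orP=> [/eqP->//|/tI].
  case/orP=> [/eqP->|/st[q qt qb]]; first by exists p; rewrite ?mem_head.
  by exists q; rewrite // inE qt orbT.
exists t; split=> // K idK tK; apply: gens.
  apply: top_coef_ideal; split=> /= [|p q [Ip Kp] [Iq Kq]|p q [Iq Kq]]; split;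
    by [exact: ideal0 | exact: idealD | exact: idealMl].
move=> a /st[p pt [szp pa]]; exists p; split=> //.
by split; [apply: tI | apply: tK].
Qed.

(** The union of the coefficient ideals is an ideal, hence finitely generated,
    and its generators all appear at some finite stage. *)
Lemma top_coef_stable : exists N, forall d a, top_coef I d a -> top_coef I N a.
Proof.
have idL : ideal (fun a => exists d, top_coef I d a).
  split=> [|a b [d La] [e Lb]|a b [d Lb]].
  - by exists 0%N; apply: ideal0; apply: top_coef_ideal.
  - exists (maxn d e); apply: idealD; first exact: top_coef_ideal.
      by apply: top_coefS La; apply: leq_maxl.
    by apply: top_coefS Lb; apply: leq_maxr.
  - by exists d; apply: idealMl => //; apply: top_coef_ideal.
have [s [sL gens]] := noethA idL.
have [N sN] : exists N, {in s, forall a, top_coef I N a}.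
  elim: s sL {gens} => [|a s IHs] sL; first by exists 0%N.
  have [d Ld] := sL a (mem_head _ _).
  have [b bs|N sN] := IHs; first by apply: sL; rewrite inE bs orbT.
  exists (maxn d N) => b; rewrite inE => /orP[/eqP->|/sN].
    by apply: top_coefS Ld; apply: leq_maxl.
  by apply: top_coefS; apply: leq_maxr.
exists N => d a La; apply: (gens _ (top_coef_ideal N idI) sN).
by exists d.
Qed.

(** Lifts of generators of the coefficient ideals up to the stable degree [N]
    suffice: the top coefficient of [p] can be cancelled with a polynomial of
    the generated ideal, times a power of ['X] beyond degree [N]. *)
Lemma poly_ideal_gens : exists s : seq {poly A},
  {in s, forall p, I p} /\
  forall K : {poly A} -> Prop, ideal K -> {in s, forall p, K p} ->
    forall p, I p -> K p.
Proof.
have [N stab] := top_coef_stable.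
have [s [sI sgens]] : exists s : seq {poly A}, {in s, forall p, I p} /\
  forall K : {poly A} -> Prop, ideal K -> {in s, forall p, K p} ->
    forall d a, (d < N.+1)%N -> top_coef I d a ->
      top_coef (fun p => I p /\ K p) d a.
  elim: N.+1 => [|k [s [sI gens]]]; first by exists [::].
  have [t [tI tgens]] := top_coef_gens k.
  exists (s ++ t); split=> [p|K idK stK d a].
    by rewrite mem_cat => /orP[/sI|/tI].
  rewrite ltnS leq_eqVlt => /orP[/eqP->|dk].
    by apply: tgens => // p pt; apply: stK; rewrite mem_cat pt orbT.
  by apply: gens => // p ps; apply: stK; rewrite mem_cat ps.
exists s; split=> // K idK sK p.
have [k] := ubnP (size p); elim: k p => // k IHk p szp Ip.
have [p0|p0] := eqVneq p 0; first by rewrite p0; apply: ideal0.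
have szE : size p = (size p).-1.+1 by rewrite prednK // size_poly_gt0.
move: (size p).-1 szE => d szE.
have [q [Iq Kq szq qd]] : exists q,
    [/\ I q, K q, (size q <= d.+1)%N & q`_d = p`_d].
  have Ld : top_coef I d p`_d by exists p; rewrite szE.
  have [dN|Nd] := ltnP d N.+1.
    by have [q [[Iq Kq] ? ?]] := sgens _ idK sK _ _ dN Ld; exists q.
  have [q [[Iq Kq] szq qN]] := sgens _ idK sK _ _ (ltnSn N) (stab _ _ Ld).
  have Nd' : (N <= d)%N by apply: ltnW.
  exists ('X^(d - N) * q); split; try exact: idealMl.
    rewrite (leq_trans (size_polyMleq _ _)) // size_polyXn addSn /=.
    by rewrite -[X in (_ <= X.+1)%N](subnK Nd') -addnS leq_add2l.
  by rewrite mulrC coefMXn ltnNge leq_subr /= subKn.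
rewrite -[p](subrK q); apply: idealD => //; apply: IHk; last exact: idealB.
rewrite (leq_trans _ (szp : (size p <= k)%N)) // szE ltnS.
apply/leq_sizeP => j; rewrite leq_eqVlt => /orP[/eqP<-|dj].
  by rewrite coefB qd subrr.
by rewrite coefB !nth_default ?subrr // ?szE // (leq_trans szq).
Qed.

End HilbertBasis.

Lemma noetherian_poly (A : comNzRingType) : noetherian A -> noetherian {poly A}.
Proof. by move=> noethA I; apply: poly_ideal_gens. Qed.

(** * Polynomial presentations of finitely generated algebras *)

(** Adjoining the elements of [ys] one at a time, a property of rings over [B]
    that survives each adjunction holds for some ring over [B] whose image
    contains [ys]. It replaces an induction on the number of variables of
    multivariate polynomials by one on iterated univariate polynomials. *)
Lemma adjoin_ind (B : comNzRingType)
    (Q : forall T : comNzRingType, {rmorphism T -> B} -> Prop) (ys : seq B) :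
  (forall (T : comNzRingType) (f : {rmorphism T -> B}) y, y \in ys -> Q T f ->
     Q {poly T} (horner_morph (fun a => mulrC y (f a)))) ->
  forall (T0 : comNzRingType) (f0 : {rmorphism T0 -> B}), Q T0 f0 ->
  exists (T : comNzRingType) (f : {rmorphism T -> B}),
    [/\ Q T f, forall a, exists b, f b = f0 a &
        {in ys, forall y, exists b, f b = y}].
Proof.
elim: ys => [|y ys IHys] step T0 f0 Q0.
  by exists T0, f0; split=> // a; exists a.
have [S|T [f [QT fT fys]]] := IHys _ T0 f0 Q0.
  by move=> f w wys; apply: step; rewrite inE wys orbT.
exists {poly T}, (horner_morph (fun a => mulrC y (f a))); split.
- by apply: step => //; apply: mem_head.
- move=> a; have [b <-] := fT a; exists b%:P; exact: horner_morphC.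
- move=> z; rewrite inE => /orP[/eqP->|/fys[b <-]].
    exists 'X; exact: horner_morphX.
  by exists b%:P; apply: horner_morphC.
Qed.

Lemma mpoly_rmorph_surj (F : comNzRingType) n (T : comNzRingType)
    (f : {rmorphism T -> {mpoly F[n]}}) :
  (forall c, exists a, f a = c%:MP) -> (forall i, exists a, f a = 'X_i) ->
  forall p, exists a, f a = p.
Proof.
move=> fC fX p; rewrite [p]mpolyE; elim/big_rec: _ => [|k q _ [a <-]].
  by exists 0; rewrite rmorph0.
have [c fc] := fC p@_k.
suff [b fb] : exists b, f b = 'X_[k].
  by exists (c * b + a); rewrite rmorphD rmorphM fc fb mul_mpolyC.
rewrite mpolyXE_id; elim/big_rec: _ => [|i r _ [b <-]].
  by exists 1; rewrite rmorph1.
by have [d fd] := fX i; exists (d ^+ k i * b); rewrite rmorphM rmorphXn fd.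
Qed.

Lemma noetherian_mpoly (F : fieldType) n : noetherian {mpoly F[n]}.
Proof.
have [||T [f [noethT fC fX]]] := @adjoin_ind {mpoly F[n]}
  (fun T _ => noetherian T) (codom (fun i : 'I_n => 'X_i)) _ F (@mpolyC n F).
- by move=> T f y _; apply: noetherian_poly.
- exact: noetherian_field.
apply: noetherian_surj noethT.
apply: mpoly_rmorph_surj => [|i]; first exact: fC.
exact: (fX _ (codom_f _ i)).
Qed.

(** * Lying over *)

(** Prime avoidance for finitely many points: a bad coefficient [k] is a root
    of the nonzero polynomial with factors [a x + b x 'X], and in characteristic
    0 some natural number is not a root. *)
Lemma exists_lin_comb_neq0 (C : numFieldType) (T : eqType) (s : seq T)
    (a b : T -> C) :
  {in s, forall x, a x != 0 \/ b x != 0} ->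
  exists k : nat, {in s, forall x, a x + k%:R * b x != 0}.
Proof.
move=> ab0; pose p := \prod_(x <- s) ((a x)%:P + (b x)%:P * 'X).
have p0 : p != 0.
  rewrite prodf_seq_neq0; apply/allP=> x /ab0 abx; apply/implyP=> _.
  apply/eqP=> e; have := congr1 (fun q : {poly C} => q`_0) e.
  have := congr1 (fun q : {poly C} => q`_1) e.
  rewrite !coefD !coefC !coefMX !coefC /= addr0 add0r ?coef0 => bx ax.
  by case: abx; rewrite ?ax ?bx eqxx.
have [k kroot] : exists k : nat, ~~ root p k%:R.
  apply: contrapT => noroot.
  pose rs : seq C := [seq k%:R | k <- iota 0 (size p)].
  suff: (size rs < size p)%N by rewrite size_map size_iota ltnn.
  apply: max_poly_roots => //.
    apply/allP=> _ /mapP[k _ ->]; apply: contrapT => /negP kp.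
    by apply: noroot; exists k.
  rewrite map_inj_uniq ?iota_uniq // => i j /eqP.
  by rewrite eqr_nat => /eqP.
exists k => x xs; apply: contraNneq kroot => e.
apply/rootP; rewrite horner_prod; apply/eqP; rewrite prodf_seq_eq0; apply/hasP.
exists x => //=.
by rewrite !hornerE -[X in _ == X]e; apply/eqP; ring.
Qed.

(** Nonvanishing of the images of the leading coefficients keeps the degrees,
    hence the shape of the Sylvester matrix. *)
Lemma rmorph_resultant (A B : nzRingType) (f : {rmorphism A -> B})
    (p q : {poly A}) :
  f (lead_coef p) != 0 -> f (lead_coef q) != 0 ->
  f (resultant p q) = resultant (map_poly f p) (map_poly f q).
Proof.
move=> fp fq; rewrite /resultant /Sylvester_mx !size_map_poly_id0 //.
rewrite -det_map_mx map_col_mx; congr (\det (col_mx _ _)).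
all: by apply: map_lin1_mx => v; rewrite map_poly_rV rmorphM /= (map_rVpoly f).
Qed.

(** The resultant of [P] and a monic modification of [q] is a combination of
    both, so its image under [f] lies in [L] and [phi] kills it; but its image
    under [phi] is the resultant of the images, which vanishes only if they
    have a common root. *)
Lemma adjoin_resultant (A B : comNzRingType) (f : {rmorphism A -> B})
    (L : B -> Prop) (C : closedFieldType) (phi : {rmorphism A -> C})
    (y : B) (P q : {poly A}) :
  ideal L -> (forall a, L (f a) -> phi a = 0) ->
  P \is monic -> L (map_poly f P).[y] -> L (map_poly f q).[y] ->
  exists2 x, root (map_poly phi P) x & root (map_poly phi q) x.
Proof.
move=> idL ker Pmon LP Lq; apply: contrapT => noroot.
have szP : (1 < size P)%N.
  rewrite ltnNge; apply/negP => szP.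
  have P1 : P = 1.
    have := monicP Pmon; rewrite (size1_polyC szP) lead_coefC => ->.
    exact: polyC1.
  have /ker/eqP : L (f 1) by move: LP; rewrite P1 !rmorph1 hornerC.
  by rewrite rmorph1 oner_eq0.
(* A multiple of P of large degree makes q monic, so that phi commutes with the
   resultant, and does not change q at the roots of P. *)
pose N := size q; pose q1 := q + 'X^N * P.
have szNP : size ('X^N * P) = (N + size P)%N.
  by rewrite size_monicM ?monicXn ?monic_neq0 // size_polyXn.
have ltq : (size q < size ('X^N * P)%R)%N.
  by rewrite szNP -addn1 leq_add2l ltnW.
have q1mon : q1 \is monic.
  by rewrite monicE /q1 lead_coefDr // -monicE rpredM ?monicXn.
have szq1 : (1 < size q1)%N.
  by rewrite /q1 addrC size_polyDl // szNP (leq_trans szP) // leq_addl.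
have [[u v] _ /= resE] := resultant_in_ideal szP szq1.
have Lres : L (f (resultant P q1)).
  have -> : f (resultant P q1) = (map_poly f (resultant P q1)%:P).[y].
    by rewrite map_polyC hornerC.
  rewrite resE rmorphD !rmorphM hornerD !hornerM.
  apply: idealD => //; apply: idealMl => //.
  rewrite /q1 rmorphD hornerD rmorphM hornerM; apply: idealD => //.
  exact: idealMl.
have /eqP := ker _ Lres.
rewrite rmorph_resultant ?(monicP Pmon) ?(monicP q1mon) ?rmorph1 ?oner_neq0 //.
rewrite resultant_eq0; apply/negP; rewrite -leqNgt.
suff /eqP-> : coprimep (map_poly phi P) (map_poly phi q1) by [].
apply/Pdiv.ClosedField.coprimepP => x Px; apply/negP => q1x; apply: noroot.
exists x => //; move: q1x; rewrite /q1 rmorphD rmorphM hornerD hornerM.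
by rewrite (rootP Px) mulr0 addr0.
Qed.

(** A root [x] to which [y] can be sent, so that [phi] extends to the algebra
    generated by [y] modulo [L]. Candidates are the roots of [P]. If each were
    excluded by some relation satisfied by [y] modulo [L], prime avoidance
    would give one relation excluding all of them, against
    [adjoin_resultant]. *)
Lemma adjoin_root (A B : comNzRingType) (f : {rmorphism A -> B})
    (L : B -> Prop) (C : numClosedFieldType) (phi : {rmorphism A -> C})
    (y : B) (P : {poly A}) :
  ideal L -> (forall a, L (f a) -> phi a = 0) ->
  P \is monic -> L (map_poly f P).[y] ->
  exists x, forall q : {poly A},
    L (map_poly f q).[y] -> (map_poly phi q).[x] = 0.
Proof.
move=> idL ker Pmon LP; apply: contrapT => noroot.
have sep x : exists2 q : {poly A},
    L (map_poly f q).[y] & (map_poly phi q).[x] != 0.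
  apply: contrapT => nosep; apply: noroot; exists x => q Lq.
  by apply/eqP; apply: contrapT => /negP qx; apply: nosep; exists q.
have [s Ps] := closed_field_poly_normal (map_poly phi P).
have [q Lq qs] : exists2 q : {poly A}, L (map_poly f q).[y] &
    {in s, forall x, (map_poly phi q).[x] != 0}.
  elim: s {Ps} => [|x s [q Lq qs]].
    by exists 0 => //; rewrite rmorph0 horner0; apply: ideal0.
  have [r Lr rx] := sep x.
  have [z|k ks] := @exists_lin_comb_neq0 C _ (x :: s)
    (horner (map_poly phi q)) (horner (map_poly phi r)).
    by rewrite inE => /orP[/eqP->|/qs]; [right|left].
  exists (q + k%:R * r).
    rewrite rmorphD rmorphM hornerD hornerM; apply: idealD => //.
    exact: idealMl.
  move=> z /ks; rewrite !rmorphD !rmorphM !rmorph_nat hornerD hornerM.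
  by rewrite -polyC_natr hornerC.
have [x Px qx] := adjoin_resultant idL ker Pmon LP Lq.
have xs : x \in s.
  move: Px; rewrite Ps rootZ ?root_prod_XsubC //.
  by rewrite lead_coef_eq0 monic_neq0 // monic_map.
by move: (qs x xs); rewrite (rootP qx) eqxx.
Qed.

(** A morphism to an algebraically closed field that kills the contraction of
    [L] extends to a morphism that kills [L], over an integral extension. The
    variables are adjoined one at a time, each with a value provided by
    [adjoin_root]. *)
Lemma lying_over (F A : comNzRingType) m (f : {rmorphism A -> {mpoly F[m]}})
    (L : {mpoly F[m]} -> Prop) (C : numClosedFieldType)
    (phi : {rmorphism A -> C}) :
  ideal L -> (forall a, L (f a) -> phi a = 0) ->
  (forall c, exists a, f a = c%:MP) ->
  (forall i, exists2 P : {poly A}, P \is monic & L (map_poly f P).['X_i]) ->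
  exists psi : {rmorphism {mpoly F[m]} -> C},
    (forall a, psi (f a) = phi a) /\ (forall q, L q -> psi q = 0).
Proof.
move=> idL ker fC fint;
pose Q (T : comNzRingType) (g : {rmorphism T -> {mpoly F[m]}}) : Prop :=
  exists (i : {rmorphism A -> T}) (phiT : {rmorphism T -> C}),
    [/\ forall a, g (i a) = f a, forall a, phiT (i a) = phi a &
        forall t, L (g t) -> phiT t = 0].
have [||T [g [[i [phiT [gi phii kerT]]] gA gX]]] :=
    @adjoin_ind _ Q (codom (fun i : 'I_m => 'X_i)) _ A f.
- move=> T g _ /codomP[j ->] [i [phiT [gi phii kerT]]].
  have [P Pmon LP] := fint j.
  have LP' : L (map_poly g (map_poly i P)).['X_j].
    rewrite -map_poly_comp; suff <- : map_poly f P = map_poly (g \o i) P by [].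
    by apply: eq_map_poly => a /=; rewrite gi.
  have [x xroot] := adjoin_root idL kerT (monic_map _ Pmon) LP'.
  exists (polyC \o i), (horner_morph (fun a => mulrC x (phiT a))).
  by split=> [a|a|q]; rewrite /= ?horner_morphC // => /xroot.
- by exists idfun, phi.
have surj : forall q, exists t, g t = q.
  apply: mpoly_rmorph_surj => [c|j]; last exact: (gX _ (codom_f _ j)).
  by have [a <-] := fC c; apply: gA.
pose pre b := xget 0 [set t | g t = b]%classic.
have preK b : g (pre b) = b.
  have [t tb] := surj b.
  by apply: (@xgetPex _ 0 [set t | g t = b]%classic); exists t.
(* The extension does not depend on the chosen preimages, because 0 is in L. *)
have eqT t t' : g t = g t' -> phiT t = phiT t'.
  move=> e; apply/eqP; rewrite -subr_eq0 -rmorphB kerT // rmorphB e subrr.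
  exact: ideal0.
pose psi b := phiT (pre b).
have psiZ : zmod_morphism psi.
  by move=> a b; rewrite /psi -rmorphB; apply: eqT; rewrite rmorphB !preK.
have psiM : monoid_morphism psi.
  split=> [|a b]; rewrite /psi.
    by rewrite -(rmorph1 phiT); apply: eqT; rewrite preK rmorph1.
  by rewrite -rmorphM; apply: eqT; rewrite rmorphM !preK.
pose m1 := GRing.isZmodMorphism.Build _ C psi psiZ.
pose m2 := GRing.isMonoidMorphism.Build _ C psi psiM.
pose psi' : {rmorphism {mpoly F[m]} -> C} := HB.pack psi m1 m2.
exists psi'; split=> [a|b Lb].
  by rewrite -phii; apply: eqT; rewrite preK gi.
by apply: kerT; rewrite preK.
Qed.

(** * Localizations and integral closures *)

Lemma inj_surj_bijective (A : pzRingType) (B : Type) (f : A -> B) :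
  injective f -> (forall b, exists a, f a = b) -> bijective f.
Proof.
move=> finj fsurj; pose g b := xget 0 [set a | f a = b]%classic.
have gK b : f (g b) = b.
  have [a ab] := fsurj b; apply: (@xgetPex _ 0 [set a | f a = b]%classic).
  by exists a.
by exists g => // a; apply: finj; rewrite gK.
Qed.

Lemma mul_unit_inj (B : comPzRingType) (t v x y : B) :
  t * v = 1 -> x * t = y * t -> x = y.
Proof.
by move=> tv e; rewrite -[x]mulr1 -[y]mulr1 -tv !mulrA e.
Qed.

Section LocalizationUniversal.

Variables (A B : comPzRingType) (S : mulrClosed A) (g : {rmorphism A -> B}).

(** The universal property of localization, for a target where division is
    available only through existing inverses. *)
Lemma loc_lift : (forall s, s \in S -> exists v, g s * v = 1) ->
  exists G : {rmorphism loc S -> B},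
    forall a s (sS : s \in S), G (loc_frac a sS) * g s = g a.
Proof.
move=> gS; pose inv s := xget 0 [set v | g s * v = 1]%classic.
have invE s : s \in S -> g s * inv s = 1.
  move=> /gS[v sv].
  by apply: (@xgetPex _ 0 [set v | g s * v = 1]%classic); exists v.
pose G (x : loc S) := g (repr x).1 * inv (sval (repr x).2).
have GE a s (sS : s \in S) : G (loc_frac a sS) * g s = g a.
  have [u uS /= e] := repr_loc (mkpair a sS).
  rewrite /G; move: (repr _) e => y e; have yS := den_in y.
  apply: (mul_unit_inj (invE _ (rpredM uS yS))).
  transitivity (g (u * (y.1 * s)) * (g (sval y.2) * inv (sval y.2))).
    by rewrite !rmorphM; ring.
  by rewrite invE // e !rmorphM; ring.
have Guniq x y a s (sS : s \in S) :
    x = loc_frac a sS -> y * g s = g a -> G x = y.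
  by move=> -> e; apply: (mul_unit_inj (invE s sS)); rewrite GE.
have GZ : zmod_morphism G.
  move=> x y; have [a [s [sS xE]]] := loc_fracP x.
  have [b [t [tS yE]]] := loc_fracP y.
  apply: (Guniq _ _ (a * t + - b * s) (s * t) (rpredM sS tS)).
    by rewrite xE yE loc_fracN loc_fracD.
  rewrite xE yE rmorphD !rmorphM rmorphN -(GE a s sS) -(GE b t tS); ring.
have GM : monoid_morphism G.
  split=> [|x y]; first by apply: (Guniq _ _ 1 1 (rpred1 S)); rewrite ?mul1r.
  have [a [s [sS xE]]] := loc_fracP x; have [b [t [tS yE]]] := loc_fracP y.
  apply: (Guniq _ _ (a * b) (s * t) (rpredM sS tS)).
    by rewrite xE yE loc_fracM.
  rewrite xE yE !rmorphM -(GE a s sS) -(GE b t tS); ring.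
pose m1 := GRing.isZmodMorphism.Build (loc S) B G GZ.
pose m2 := GRing.isMonoidMorphism.Build (loc S) B G GM.
pose G' : {rmorphism loc S -> B} := HB.pack G m1 m2.
by exists G'.
Qed.

End LocalizationUniversal.

Section Denominators.

Variables (A : comPzRingType) (S T : mulrClosed A) (ST : {subset S <= T}).

Lemma loc_injK (s : A) (sS : s \in S) : loc_inj S s * loc_frac 1 sS = 1.
Proof. by rewrite loc_fracM; apply: loc_eq => /=; ring. Qed.

Lemma loc_fracE a s (sS : s \in S) : loc_inj S s * loc_frac a sS = loc_inj S a.
Proof. by rewrite loc_fracM; apply: loc_eq => /=; ring. Qed.

Lemma loc_map_inj a : loc_map ST (loc_inj S a) = loc_inj T a.
Proof. by rewrite loc_map_frac; apply: loc_eq. Qed.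

Lemma common_denominator d (c : 'I_d -> loc S) :
  exists2 s, s \in S & exists a : 'I_d -> A,
    forall i, loc_inj S s * c i = loc_inj S (a i).
Proof.
have frac i : exists q : fracpair S, loc_inj S (sval q.2) * c i = loc_inj S q.1.
  have [a [s [sS ->]]] := loc_fracP (c i).
  by exists (mkpair a sS); apply: loc_fracE.
have [p pE] := choice frac.
pose s i := sval (p i).2.
exists (\prod_i s i); first by apply: rpred_prod => i _; apply: den_in.
exists (fun i => (p i).1 * \prod_(j | j != i) s j) => i.
by rewrite (bigD1 i) //= !rmorphM /= -pE mulrAC.
Qed.

(** If [s] clears the denominators of the coefficients of a monic equation of
    degree [d] for [k], then multiplying it by [s ^+ d] gives one for [s k]. *)
Lemma integral_over_denominator (k : loc T) :
  k \in integral_over (loc_map ST) ->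
  exists2 s, s \in S & loc_inj T s * k \in integral_over (loc_inj T).
Proof.
case/asboolP=> d [c kE]; have [s sS [a cE]] := common_denominator c.
exists s => //; apply/asboolP.
exists d, (fun i => a i * s ^+ (d - i.+1)).
apply: etrans (etrans (congr1 ( *%R (loc_inj T s ^+ d)) kE) (mulr0 _)).
rewrite mulrDr exprMn mulr_sumr.
congr (_ + _); apply: eq_bigr => i _.
have aE : loc_inj T (a i) = loc_inj T s * loc_map ST (c i).
  by rewrite -(loc_map_inj (a i)) -cE rmorphM /= loc_map_inj.
rewrite rmorphM rmorphXn exprMn /= aE -[X in _ = _ ^+ X * _](subnK (ltn_ord i)).
by rewrite addnS exprS exprD; ring.
Qed.

Lemma integral_over_loc (k : loc T) :
  k \in integral_over (loc_inj T) -> k \in integral_over (loc_map ST).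
Proof.
case/asboolP=> d [c kE]; apply/asboolP; exists d, (fun i => loc_inj S (c i)).
apply: etrans kE; congr (_ + _); apply: eq_bigr => i _.
by rewrite /= loc_map_inj.
Qed.

End Denominators.

Lemma integral_over_image (A B : comPzRingType) (f : {rmorphism A -> B}) a :
  f a \in integral_over f.
Proof.
apply/asboolP; exists 1%N, (fun=> - a).
by rewrite big_ord1 expr0 expr1 mulr1 rmorphN subrr.
Qed.

(** * Evaluation at complex points *)

Section RealPoints.

Variables (R : realType) (n : nat).
Implicit Types (X : set 'rV[R]_n) (p : {mpoly R[n]}).

Definition evalC (z : 'rV[R[i]]_n) (p : {mpoly R[n]}) : R[i] :=
  (map_mpoly (real_complex R) p).@[z ord0].

Lemma evalC_zmod z : zmod_morphism (evalC z).
Proof. by move=> p q; rewrite /evalC rmorphB mevalB. Qed.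

Lemma evalC_monoid z : monoid_morphism (evalC z).
Proof.
by split=> [|p q]; rewrite /evalC ?rmorph1 ?meval1 // rmorphM mevalM.
Qed.

HB.instance Definition _ z := GRing.isZmodMorphism.Build
  {mpoly R[n]} R[i] (evalC z) (evalC_zmod z).
HB.instance Definition _ z := GRing.isMonoidMorphism.Build
  {mpoly R[n]} R[i] (evalC z) (evalC_monoid z).

Lemma evalC_const z c : evalC z c%:MP = real_complex R c.
Proof. by rewrite /evalC map_mpolyC mevalC. Qed.

Lemma evalC_var z j : evalC z 'X_j = z ord0 j.
Proof. by rewrite /evalC map_mpolyX mevalXU. Qed.

Lemma evalC_real x p :
  evalC (map_mx (real_complex R) x) p = real_complex R p.@[x ord0].
Proof.
rewrite /evalC -[RHS](@meval_map_mpoly _ _ (real_complex R) n p (x ord0)).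
by apply: meval_eq => j; rewrite mxE.
Qed.

Lemma evalC_unique (psi : {rmorphism {mpoly R[n]} -> R[i]}) (z : 'rV[R[i]]_n) :
  (forall c, psi c%:MP = real_complex R c) ->
  (forall j, psi 'X_j = z ord0 j) ->
  forall p, psi p = evalC z p.
Proof.
move=> psiC psiX p; rewrite [p]mpolyE !rmorph_sum; apply: eq_bigr => k _.
rewrite -mul_mpolyC !rmorphM /= psiC evalC_const; congr (_ * _).
rewrite mpolyXE_id !rmorph_prod; apply: eq_bigr => j _.
by rewrite !rmorphXn /= evalC_var psiX.
Qed.

Lemma evalC_congr X z p q : complexification X z ->
  polyfun_class X p = polyfun_class X q -> evalC z p = evalC z q.
Proof.
move=> Xz /polyfun_classP pq; apply/eqP; rewrite -subr_eq0 -rmorphB.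
by apply/eqP/Xz/asboolP => x Xx; rewrite mevalB pq // subrr.
Qed.

(** The polynomials defining [X] belong to its vanishing ideal. *)
Lemma complexification_real X x : real_algebraic X ->
  complexification X (map_mx (real_complex R) x) <-> X x.
Proof.
case=> P ->; split=> [Xx p Pp|Xx p /asboolP p0]; last first.
  by rewrite -/(evalC _ p) evalC_real p0 // rmorph0.
apply: complexI; rewrite -evalC_real rmorph0; apply: Xx.
by apply/asboolP => y; apply.
Qed.

Lemma nonreal_coord (z : 'rV[R[i]]_n) :
  ~ (exists x, map_mx (real_complex R) x = z) ->
  exists j, complex.Im (z ord0 j) != 0.
Proof.
move=> zreal; apply: contrapT => /forallNP z0; apply: zreal.
exists (map_mx (@complex.Re R) z); apply/rowP=> j; rewrite !mxE.
have /negP := z0 j; rewrite negbK; case: (z ord0 j) => a b /= /eqP->.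
by [].
Qed.

(** If the coordinate is [a + b i], then [('X_j - a) / b] takes the value
    [i]. *)
Lemma evalC_root_sqrD1 (z : 'rV[R[i]]_n) j : complex.Im (z ord0 j) != 0 ->
  exists q, evalC z (1 + q ^+ 2) = 0.
Proof.
case zj: (z ord0 j) => [a b] /= b0.
exists ((b^-1)%:MP * ('X_j - a%:MP)).
rewrite rmorphD rmorph1 rmorphXn rmorphM rmorphB /= !evalC_const evalC_var zj.
by simpc; rewrite mulVf // mulr1 subrr.
Qed.

End RealPoints.

Section PullBack.

Variables (R : realType) (n m : nat) (u : n.-tuple {mpoly R[m]}).

Lemma meval_polymap (y : 'rV[R]_m) p :
  (p \mPo u).@[y ord0] = p.@[polymap u y ord0].
Proof. by rewrite comp_mpoly_meval; apply: meval_eq => j; rewrite mxE. Qed.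

Lemma evalC_polymapC z p : evalC z (p \mPo u) = evalC (polymapC u z) p.
Proof.
pose psi : {rmorphism {mpoly R[n]} -> R[i]} := evalC z \o comp_mpoly u.
have psiC c : psi c%:MP = real_complex R c.
  by rewrite /= comp_mpolyC evalC_const.
have psiX j : psi 'X_j = polymapC u z ord0 j.
  by rewrite [RHS]mxE -[LHS]/(evalC z ('X_j \mPo u)) comp_mpolyXU -tnth_nth.
by rewrite -[LHS]/(psi p); apply: evalC_unique.
Qed.

Lemma polymapC_real y :
  polymapC u (map_mx (real_complex R) y) =
  map_mx (real_complex R) (polymap u y).
Proof. by apply/rowP=> j; rewrite !mxE; apply: evalC_real. Qed.

End PullBack.

(** * Regular functions and the normalization *)

Section Normalization.

Variables (R : realType) (n m : nat).
Variables (X : set 'rV[R]_n) (X' : set 'rV[R]_m) (u : n.-tuple {mpoly R[m]}).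

Lemma normalization_embedding : is_normalization X X' u ->
  exists Phi : {rmorphism polyfun X' -> totfrac (polyfun X)},
    [/\ injective Phi,
        forall k, k \in integral_over (@polyfun_frac R n X) <->
                  exists b, Phi b = k &
        forall p, Phi (polyfun_class X' (p \mPo u)) =
                  polyfun_frac X (polyfun_class X p)].
Proof.
case=> _ _ [phi [[phi' phiK phi'K] phiE]].
pose Phi : {rmorphism polyfun X' -> totfrac (polyfun X)} := \val \o phi.
exists Phi; split=> [b c /val_inj/(can_inj phiK)//|k|//].
split=> [kint|[b <-]]; last exact: (valP (phi b)).
by exists (phi' (IntClosure kint)); rewrite /Phi /= phi'K.
Qed.

End Normalization.

(** For [f = a / s], the inverse is [s^2 / (s^2 + a^2)]. *)
Lemma regular_sqrD1_unit (R : realType) n (X : set 'rV[R]_n) (f : regular X) :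
  exists v, (1 + f ^+ 2) * v = 1.
Proof.
have [a [s [sS ->]]] := loc_fracP f.
have dS : s ^+ 2 + a ^+ 2 \in @nowhere_zero R n X.
  apply/asboolP=> x Xx; move/asboolP: sS => /(_ x Xx) s0.
  rewrite polyfun_evalD // !expr2 !polyfun_eval_mul // -!expr2.
  by rewrite paddr_eq0 ?sqr_ge0 // !expf_eq0 /= (negbTE s0).
exists (loc_frac (s ^+ 2) dS).
have -> : (1 : regular X) = loc_frac 1 (rpred1 _) by [].
rewrite expr2 !(loc_fracM, loc_fracD); apply: loc_eq => /=; ring.
Qed.

Section RegularClosure.

Variables (R : realType) (n m : nat).
Variables (X : set 'rV[R]_n) (X' : set 'rV[R]_m) (u : n.-tuple {mpoly R[m]}).
Variable Phi : {rmorphism polyfun X' -> totfrac (polyfun X)}.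
Hypothesis uX : (polymap u @` X' `<=` X)%classic.
Hypothesis Phi_inj : injective Phi.
Hypothesis PhiP : forall k, k \in integral_over (@polyfun_frac R n X) <->
  exists b, Phi b = k.
Hypothesis PhiE : forall p, Phi (polyfun_class X' (p \mPo u)) =
  polyfun_frac X (polyfun_class X p).

Lemma nowhere_zero_comp p : polyfun_class X p \in @nowhere_zero R n X ->
  polyfun_class X' (p \mPo u) \in @nowhere_zero R m X'.
Proof.
move=> /asboolP p0; apply/asboolP=> y X'y.
have Xuy : X (polymap u y) by apply: uX; exists y.
by rewrite polyfun_evalE // meval_polymap -(polyfun_evalE _ Xuy); apply: p0.
Qed.

(** This is what makes [O(X)'] a localization of [P(X')]: the denominator is a
    common denominator of the coefficients of an integral equation. *)
Lemma regular_closure_denominator k :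
  k \in integral_over (@regular_frac R n X) ->
  exists2 p, polyfun_class X p \in @nowhere_zero R n X &
    exists b, Phi b = Phi (polyfun_class X' (p \mPo u)) * k.
Proof.
move=> /integral_over_denominator[s sS /PhiP skint].
exists (polyfun_repr s); first by rewrite polyfun_reprK.
by rewrite PhiE polyfun_reprK.
Qed.

Lemma regular_closure_embedding :
  exists g : {rmorphism polyfun X' -> intclosure (@regular_frac R n X)},
    forall b, \val (g b) = Phi b.
Proof.
have Phiint b : Phi b \in integral_over (@regular_frac R n X).
  by apply: integral_over_loc; apply/PhiP; exists b.
pose g b := IntClosure (Phiint b).
have gZ : zmod_morphism g by move=> a b; apply: val_inj; rewrite /= rmorphB.
have gM : monoid_morphism g.
  by split=> [|a b]; apply: val_inj; rewrite /= ?rmorph1 ?rmorphM.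
pose m1 := GRing.isZmodMorphism.Build _ _ g gZ.
pose m2 := GRing.isMonoidMorphism.Build _ _ g gM.
pose g' : {rmorphism polyfun X' -> intclosure (@regular_frac R n X)} :=
  HB.pack g m1 m2.
by exists g'.
Qed.

(** Invertibility of [1 + b ^+ 2] in [O(X)'], transported from [O(X')] by an
    arbitrary ring isomorphism, then written without denominators. *)
Lemma regular_closure_sqrD1 (b : polyfun X') :
  ring_isomorphic (intclosure (@regular_frac R n X)) (regular X') ->
  exists2 p, polyfun_class X p \in @nowhere_zero R n X &
    exists c, c * (1 + b ^+ 2) = polyfun_class X' (p \mPo u).
Proof.
case=> h [h' hK h'K]; have [g gE] := regular_closure_embedding.
have [v hv] := regular_sqrD1_unit (h (g b)).
have gv : (1 + g b ^+ 2) * h' v = 1.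
  apply: (can_inj hK); rewrite rmorphM rmorphD rmorphXn rmorph1.
  by rewrite h'K.
have [p pS [c cE]] := regular_closure_denominator (valP (h' v)).
exists p => //; exists c; apply: Phi_inj.
have ev : (1 + Phi b ^+ 2) * \val (h' v) = 1.
  by rewrite -gE; exact: (congr1 \val gv).
rewrite rmorphM cE rmorphD rmorphXn rmorph1 -mulrA (mulrC _ (1 + _)) ev.
exact: mulr1.
Qed.

(** The hypothesis makes every denominator of [O(X')] invertible in [O(X)'], so
    that the embedding of [P(X')] extends to [O(X')]. The extension is onto by
    [regular_closure_denominator], since pullbacks of functions without zero
    on [X] have no zero on [X']. *)
Lemma regular_closure_iso :
  (forall t : polyfun X', t \in @nowhere_zero R m X' ->
    exists2 p, polyfun_class X p \in @nowhere_zero R n X &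
      exists b, t * b = polyfun_class X' (p \mPo u)) ->
  ring_isomorphic (intclosure (@regular_frac R n X)) (regular X').
Proof.
move=> div; have [g gE] := regular_closure_embedding.
have gS p : polyfun_class X p \in @nowhere_zero R n X ->
    exists v, g (polyfun_class X' (p \mPo u)) * v = 1.
  move=> pS; exists (IntClosure
    (integral_over_image (@regular_frac R n X) (loc_frac 1 pS))).
  apply: val_inj; rewrite /= gE PhiE.
  rewrite -[polyfun_frac X _](loc_map_inj (@nowhere_zero_nonzerodiv R n X)).
  by rewrite -[LHS](rmorphM (@regular_frac R n X)) loc_injK rmorph1.
have gS' t : t \in @nowhere_zero R m X' -> exists v, g t * v = 1.
  move=> /div[p /gS[v pv] [b tb]]; exists (g b * v).
  by rewrite mulrA -rmorphM tb.
have [G GE] := loc_lift gS'.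
have Ginj : injective G.
  move=> x y /eqP; rewrite -subr_eq0 -rmorphB => /eqP Gxy.
  apply/eqP; rewrite -subr_eq0; move: (x - y) Gxy => z.
  have [a [s [sS ->]]] := loc_fracP z => Gz.
  have a0 : a = 0.
    have ga : g a = g 0 by rewrite -(GE a s sS) Gz mul0r rmorph0.
    by apply: Phi_inj; rewrite -!gE ga.
  by rewrite a0; apply/eqP/loc_eq => /=; ring.
have Gsurj k : exists x, G x = k.
  have [p pS [b bE]] := regular_closure_denominator (valP k).
  have [v pv] := gS p pS.
  exists (loc_frac b (nowhere_zero_comp pS)).
  apply: (mul_unit_inj pv); rewrite GE; apply: val_inj.
  by rewrite /= !gE bE mulrC.
have [H GK HK] := inj_surj_bijective Ginj Gsurj.
have HZ : zmod_morphism H.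
  by move=> a b; apply: Ginj; rewrite rmorphB !HK.
have HM : monoid_morphism H.
  by split=> [|a b]; apply: Ginj; rewrite ?rmorph1 ?rmorphM !HK.
pose m1 := GRing.isZmodMorphism.Build _ _ H HZ.
pose m2 := GRing.isMonoidMorphism.Build _ _ H HM.
pose H' : {rmorphism intclosure (@regular_frac R n X) -> regular X'} :=
  HB.pack H m1 m2.
by exists H', G.
Qed.

End RegularClosure.

(** * Totally real normalizations *)

Section TotallyReal.

Variables (R : realType) (n m : nat).
Variables (X : set 'rV[R]_n) (X' : set 'rV[R]_m) (u : n.-tuple {mpoly R[m]}).
Hypothesis nX' : is_normalization X X' u.

(** Polynomial functions on [X'] are integral over those of [X]; the equation
    is lifted to polynomials because [lying_over] works with those. *)
Lemma polyfun_integral (q : {mpoly R[m]}) : exists2 P : {poly {mpoly R[n]}},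
  P \is monic & polyfun_class X' (map_poly (comp_mpoly u) P).[q] = 0.
Proof.
have [Phi [Phi_inj PhiP PhiE]] := normalization_embedding nX'.
have /asboolP[d [c cE]] :
    Phi (polyfun_class X' q) \in integral_over (@polyfun_frac R n X).
  by apply/PhiP; exists (polyfun_class X' q).
pose S := \sum_(i < d) polyfun_repr (c i) *: 'X^i.
exists ('X^d + S).
  rewrite monicE lead_coefDl ?lead_coefXn // size_polyXn ltnS.
  apply: leq_trans (size_sum _ _ _) _; apply/bigmax_leqP => i _.
  by rewrite (leq_trans (size_scale_leq _ _)) // size_polyXn.
apply: Phi_inj; rewrite rmorph0 -[RHS]cE.
rewrite rmorphD rmorph_sum /= map_polyXn hornerD hornerXn horner_sum.
rewrite !rmorphD !rmorph_sum !rmorphXn; congr (_ + _); apply: eq_bigr => i _.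
rewrite map_polyZ map_polyXn hornerZ hornerXn !rmorphM !rmorphXn /= PhiE.
by rewrite polyfun_reprK.
Qed.

(** The ideal of those [p] whose pullback is divisible by [t] has no zero on
    [X], by lying over and the hypothesis that fibres over real points are
    real. The sum of the squares of finitely many generators is then a member
    without zero on [X]. *)
Lemma totally_real_divisor (t : polyfun X') :
  totally_real_normalization X X' u -> t \in @nowhere_zero R m X' ->
  exists2 p, polyfun_class X p \in @nowhere_zero R n X &
    exists b, t * b = polyfun_class X' (p \mPo u).
Proof.
move=> trX /asboolP t0.
pose L (q : {mpoly R[m]}) := exists b, t * b = polyfun_class X' q.
have idL : ideal L.
  split=> [|p q [b bE] [c cE]|p q [b bE]].
  - by exists 0; rewrite mulr0 rmorph0.
  - by exists (b + c); rewrite mulrDr bE cE rmorphD.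
  - by exists (polyfun_class X' p * b); rewrite mulrCA bE rmorphM.
pose J (p : {mpoly R[n]}) := L (p \mPo u).
have idJ : ideal J.
  split=> [|p q|p q]; rewrite /J ?rmorph0 ?rmorphD ?rmorphM.
  - exact: ideal0.
  - exact: idealD.
  - exact: idealMl.
(* If evaluation at x killed J, it would extend to P(X') and kill t there. *)
have J0 x : X x -> exists2 p, J p & p.@[x ord0] != 0.
  move=> Xx; apply: contrapT => noJ.
  pose xC := map_mx (real_complex R) x.
  have ker (p : {mpoly R[n]}) : L (comp_mpoly u p) -> evalC xC p = 0.
    move=> Jp; rewrite evalC_real; have [->|p0] := eqVneq p.@[x ord0] 0.
      exact: rmorph0.
    by case: noJ; exists p.
  have [c|i|psi [psiA psiL]] := lying_over idL ker.
  - by exists c%:MP; rewrite /= comp_mpolyC.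
  - have [P Pmon PX] := polyfun_integral 'X_i.
    by exists P => //; exists 0; rewrite mulr0 PX.
  (* The extended morphism is evaluation at a point z of the complexification
     of X' lying over x. *)
  pose z : 'rV[R[i]]_m := \row_j psi 'X_j.
  have psiE q : psi q = evalC z q.
    apply: evalC_unique => [c|j]; last by rewrite mxE.
    by rewrite -(comp_mpolyC c u) psiA /= evalC_const.
  have zX' : complexification X' z.
    move=> q q0; rewrite -/(evalC z q) -psiE; apply: psiL; exists 0.
    rewrite mulr0 -(rmorph0 (polyfun_class X')); apply/polyfun_classP => y X'y.
    by move/asboolP: q0 => ->; rewrite ?meval0.
  have zx : polymapC u z = xC.
    apply/rowP=> j; rewrite [LHS]mxE -/(evalC z _) -psiE (tnth_nth 0).
    by rewrite -comp_mpolyXU psiA /= evalC_var.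
  have : (complexification X' `&` polymapC u @^-1` real_points X)%classic z.
    by split=> //; exists x.
  rewrite trX => -[y X'y zy].
  have := t0 y X'y; rewrite -{1}[t]polyfun_reprK polyfun_evalE //.
  suff : real_complex R (polyfun_repr t).@[y ord0] = 0.
    by case=> ->; rewrite eqxx.
  rewrite -evalC_real zy -psiE; apply: psiL.
  by exists 1; rewrite mulr1 polyfun_reprK.
have [s [sJ gens]] := @noetherian_mpoly R n J idJ.
exists (\sum_(a <- s) a ^+ 2).
  apply/asboolP => x Xx; rewrite polyfun_evalE //.
  have [p Jp p0] := J0 x Xx; apply: contra_neq p0 => s0.
  pose K (q : {mpoly R[n]}) := q.@[x ord0] = 0.
  apply: (gens K) => // [|a sa]; rewrite /K.
    split=> [|a b a0 b0|a b b0]; first exact: meval0.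
      by rewrite mevalD a0 b0 addr0.
    by rewrite mevalM b0 mulr0.
  move/eqP: s0; rewrite rmorph_sum psumr_eq0 => [/allP/(_ a sa)|b _].
    by rewrite /= rmorphXn sqrf_eq0 => /eqP.
  by rewrite rmorphXn sqr_ge0.
rewrite -/(L _) -/(J _) big_seq.
elim/big_rec: _ => [|a p sa Jp]; first exact: ideal0.
by apply: idealD => //; rewrite expr2; apply: idealMl => //; apply: sJ.
Qed.

End TotallyReal.

Theorem proposition3p2 (R : realType) (n m : nat)
    (X : set 'rV[R]_n) (X' : set 'rV[R]_m) (pi' : n.-tuple {mpoly R[m]})
    (hX : real_algebraic X) (hX' : is_normalization X X' pi') :
  ring_isomorphic (intclosure (regular_frac X)) (regular X') <->
  totally_real_normalization X X' pi'.
Proof.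
have [Phi [Phi_inj PhiP PhiE]] := normalization_embedding hX'.
have [algX' piX _] := hX'.
split=> [iso|trX]; last first.
  apply: (regular_closure_iso piX Phi_inj PhiP PhiE) => t.
  exact: totally_real_divisor.
rewrite /totally_real_normalization eqEsubset; split=> z; last first.
  move=> [y X'y <-]; split; first exact/complexification_real.
  exists (polymap pi' y); first by apply: piX; exists y.
  by rewrite polymapC_real.
move=> [X'z [x Xx xz]].
have [[y yz]|/nonreal_coord[j zj]] :=
  pselect (exists y, map_mx (real_complex R) y = z).
  by exists y => //; apply/(complexification_real _ algX'); rewrite yz.
have [q q0] := evalC_root_sqrD1 zj.
have [p pS [c cE]] :=
  regular_closure_sqrD1 Phi_inj PhiP PhiE (polyfun_class X' q) iso.
move: cE; rewrite -[c]polyfun_reprK -rmorphXn -(rmorph1 (polyfun_class X')).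
rewrite -rmorphD -rmorphM => /(evalC_congr X'z).
rewrite rmorphM /= q0 mulr0 evalC_polymapC -xz evalC_real => /esym/eqP.
rewrite -(rmorph0 (real_complex R)) => /eqP/complexI px.
by move/asboolP: pS => /(_ x Xx); rewrite polyfun_evalE // px eqxx.
Qed.
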